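(* Let $k\ge1$. Let $\mu$ be a Borel probability measure on $\mathbb{R}^N$ with finite second moments and whose support has at least $k$ points. Assume $\{\mu_m\}_{m\in\mathbb{N}}$ is a sequence of probability measures on $\mathbb{R}^N$ with finite second moments which converges in the Wasserstein distance $d_2$ to $\mu$. For each $m$ let $\mathbf{z}^m=(z_1^m,\dots,z_k^m)$ be a minimizer of $F_{\mu_m,k}$. If $\mathbf{z}^m$ converges along a subsequence to $\mathbf{z}=(z_1,\dots,z_k)$, then, along that subsequence, the measures $\mu_m\llcorner_{G_i^m}$ converge weakly in the sense of measures to $\mu\llcorner_{G_i}$ as $m\to\infty$, for all $i=1,\dots,k$, where $$G_i^m=\{x\in\mathbb{R}^N: d(x,\{z_1^m,\dots,z_k^m\})=|x-z_i^m|\},\qquad G_i=\{x\in\mathbb{R}^N: d(x,\{z_1,\dots,z_k\})=|x-z_i|\}$$ are the Voronoi cells.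
   Context: For a measure $\mu$ on $\mathbb{R}^N$ with finite second moments and $\mathbf{z}=(z_1,\dots,z_k)$ with $z_i\in\mathbb{R}^N$, $F_{\mu,k}(\mathbf{z})=\int_{\mathbb{R}^N}d(x,\{z_1,\dots,z_k\})^2\,d\mu(x)$, where $d(x,\cdot)$ is the Euclidean distance to the set. The Wasserstein distance is $d_2(\mu,\tilde\mu)=\min_{\pi\in\Gamma(\mu,\tilde\mu)}\big(\iint|x-y|^2d\pi(x,y)\big)^{1/2}$, with $\Gamma(\mu,\tilde\mu)$ the set of couplings. $\mu\llcorner_A$ denotes the restriction of $\mu$ to $A$. Weak convergence is tested against bounded continuous functions. *)

(* Defs.v *)
(* R^N is 'rV[R]_N over an arbitrary R : realType, with its
   library topology. *)
From HB Require Import structures.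
From mathcomp Require Import all_boot all_order all_algebra.
From mathcomp Require Import all_classical all_reals all_analysis.
Set Implicit Arguments.
Unset Strict Implicit.
Unset Printing Implicit Defensive.
Import Order.TTheory GRing.Theory Num.Theory.
Import numFieldNormedType.Exports.
Local Open Scope classical_set_scope.
Local Open Scope ring_scope.

(* The library puts no sigma-algebra on matrices; we equip 'rV[R]_N with the
   Borel one.  Its topology comes from the sup-norm, hence is the Euclidean
   one. *)
HB.instance Definition _ (R : realType) (N : nat) := @isMeasurable.Build
  (sigma_display (@open 'rV[R]_N)) 'rV[R]_N <<s @open 'rV[R]_N >>
  (@sigma_algebra0 _ setT (@open 'rV[R]_N))
  (@sigma_algebraC _ (@open 'rV[R]_N))
  (@sigma_algebra_bigcup _ setT (@open 'rV[R]_N)).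

(* The library norm `|v| on 'rV[R]_N is the sup-norm, so the Euclidean norm is
   defined separately. *)
Definition enorm {R : realType} {N : nat} (v : 'rV[R]_N) : R :=
  Num.sqrt (\sum_(i < N) v ord0 i ^+ 2).

Definition edist_set {R : realType} {N : nat}
    (x : 'rV[R]_N) (A : set 'rV[R]_N) : R :=
  inf [set enorm (x - y) | y in A].

Definition finite_second_moment {R : realType} {N : nat}
    (mu : {measure set 'rV[R]_N -> \bar R}) : Prop :=
  (\int[mu]_x (enorm x ^+ 2)%:E < +oo)%E.

Definition quantization_cost {R : realType} {N k : nat}
    (mu : {measure set 'rV[R]_N -> \bar R}) (z : 'I_k -> 'rV[R]_N) : \bar R :=
  (\int[mu]_x (edist_set x (range z) ^+ 2)%:E)%E.

Definition is_minimizer {R : realType} {N k : nat}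
    (mu : {measure set 'rV[R]_N -> \bar R}) (z : 'I_k -> 'rV[R]_N) : Prop :=
  forall w : 'I_k -> 'rV[R]_N,
    (quantization_cost mu z <= quantization_cost mu w)%E.

Definition supp {R : realType} {N : nat}
    (mu : {measure set 'rV[R]_N -> \bar R}) : set 'rV[R]_N :=
  [set x | forall U : set 'rV[R]_N, open U -> U x -> (0 < mu U)%E].

Definition coupling {R : realType} {N : nat}
    (mu nu : probability 'rV[R]_N R) :
    set (probability ('rV[R]_N * 'rV[R]_N)%type R) :=
  [set pi | forall A : set 'rV[R]_N, measurable A ->
     pushforward pi fst A = mu A /\ pushforward pi snd A = nu A].

(* The infimum over couplings is attained, so it is the usual minimum. *)
Definition wasserstein2 {R : realType} {N : nat}
    (mu nu : probability 'rV[R]_N R) : \bar R :=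
  ereal_inf [set ((\int[pi]_p (enorm (p.1 - p.2) ^+ 2)%:E) `^ 2^-1)%E
            | pi in coupling mu nu].

Definition weak_cvg {R : realType} {N : nat}
    (mu_ : nat -> {measure set 'rV[R]_N -> \bar R})
    (mu : {measure set 'rV[R]_N -> \bar R}) : Prop :=
  forall f : 'rV[R]_N -> R, continuous f -> bounded_fun f ->
    (\int[mu_ n]_x (f x)%:E)%E @[n --> \oo] --> (\int[mu]_x (f x)%:E)%E.

Definition voronoi {R : realType} {N k : nat} (z : 'I_k -> 'rV[R]_N)
    (i : 'I_k) : set 'rV[R]_N :=
  [set x | edist_set x (range z) = enorm (x - z i)].

Lemma enorm_ge0 (R : realType) (N : nat) (v : 'rV[R]_N) : 0 <= enorm v.
Proof. exact: sqrtr_ge0. Qed.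

Lemma enorm_continuous (R : realType) (N : nat) (a : 'rV[R]_N) :
  continuous (fun x : 'rV[R]_N => enorm (x - a)).
Proof.
move=> x; rewrite /enorm.
apply: (@continuous_comp _ _ _
  (fun y : 'rV[R]_N => \sum_(i < N) (y - a) ord0 i ^+ 2) Num.sqrt);
  last exact: sqrt_continuous.
move: x; apply: (continuous_big (@add_continuous _)) => i _ x.
have cB : {for x, continuous (fun y : 'rV[R]_N => y ord0 i - a ord0 i)}.
  exact: (cvgB (@coord_continuous R 1 N ord0 i x) (cvg_cst _)).
rewrite (_ : (fun y => (y - a) ord0 i ^+ 2) =
    (fun y => (y ord0 i - a ord0 i) * (y ord0 i - a ord0 i))).
  exact: (cvgM cB cB).
by apply/funext => y; rewrite !mxE expr2.
Qed.

Lemma voronoiE (R : realType) (N k : nat) (z : 'I_k -> 'rV[R]_N) (i : 'I_k) :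
  voronoi z i =
  \bigcap_(j in [set: 'I_k]) [set x | enorm (x - z i) - enorm (x - z j) <= 0].
Proof.
have lb0 x : has_lbound [set enorm (x - y) | y in range z].
  by exists 0 => _ [y _ <-]; exact: enorm_ge0.
apply/seteqP; split=> [x /= xz j _ /=|x xz /=].
- rewrite subr_le0 -xz; apply: ge_inf => //.
  by exists (z j) => //; exists j.
- apply/eqP; rewrite eq_le; apply/andP; split.
    by apply: ge_inf => //; exists (z i) => //; exists i.
  apply: lb_le_inf; first by exists (enorm (x - z i)), (z i) => //; exists i.
  by move=> _ [_ [j _ <-] <-]; rewrite -subr_le0; exact: (xz j I).
Qed.

Lemma closed_voronoi (R : realType) (N k : nat) (z : 'I_k -> 'rV[R]_N)
    (i : 'I_k) : closed (voronoi z i).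
Proof.
rewrite voronoiE; apply: closed_bigI => j _.
have cF : continuous (fun x : 'rV[R]_N =>
    enorm (x - z i) - enorm (x - z j)).
  move=> x; exact: (cvgB (@enorm_continuous _ _ (z i) x)
    (@enorm_continuous _ _ (z j) x)).
exact: (preimage_closed (fun x _ => cF x) (@closed_le _ 0)).
Qed.

Lemma measurable_voronoi (R : realType) (N k : nat) (z : 'I_k -> 'rV[R]_N)
    (i : 'I_k) : measurable (voronoi z i).
Proof.
rewrite -[voronoi z i]setCK; apply: measurableC.
by apply: sub_sigma_algebra; apply: closed_openC; exact: closed_voronoi.
Qed.

(* Main.v *)
(* For an optimal z the boundaries between Voronoi cells are mu-null: if the cells
   of z_i and z_j shared a set A of positive mass, moving z_i by +- t (z_j - z_i)
   would on average gain a term linear in t on A and lose only one quadratic in t.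
   Optimality passes to limits because the cost is stable under couplings, and the
   hypothesis on the support makes the points of an optimal z distinct.  Off the
   boundaries, f 1_{G_i^m} converges to f 1_{G_i} jointly in m and in the point,
   so the integrals along couplings of mu_m and mu with vanishing transport cost
   converge, as in the extended continuous mapping theorem. *)
Require Import Defs.
From mathcomp Require Import all_boot all_order all_algebra.
From mathcomp Require Import all_classical all_reals all_analysis.
From mathcomp Require Import measurable_realfun.
From mathcomp Require Import ring lra.
Import Order.TTheory GRing.Theory Num.Theory.
Import numFieldNormedType.Exports.
Local Open Scope classical_set_scope.
Local Open Scope card_scope.
Local Open Scope ring_scope.
Set Implicit Arguments.
Unset Strict Implicit.

(** * The Euclidean norm on row vectors *)

Section euclidean_norm.
Context {R : realType} {N : nat}.
Implicit Types u v x y : 'rV[R]_N.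

Lemma enorm_sqr v : enorm v ^+ 2 = \sum_(i < N) v ord0 i ^+ 2.
Proof. by rewrite sqr_sqrtr// sumr_ge0// => i _; exact: sqr_ge0. Qed.

Lemma enormN v : enorm (- v) = enorm v.
Proof. by congr Num.sqrt; apply: eq_bigr => i _; rewrite mxE sqrrN. Qed.

Lemma enormBC x y : enorm (x - y) = enorm (y - x).
Proof. by rewrite -enormN opprB. Qed.

Lemma enorm0 : enorm (0 : 'rV[R]_N) = 0.
Proof.
by rewrite /enorm big1 ?sqrtr0// => i _; rewrite mxE expr0n.
Qed.

Lemma enorm_eq0 v : enorm v = 0 -> v = 0.
Proof.
move=> v0; have /eqP := enorm_sqr v; rewrite v0 expr0n/= eq_sym.
rewrite psumr_eq0 => [/allP v00|i _]; last exact: sqr_ge0.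
apply/rowP => i; rewrite mxE; apply/eqP.
by rewrite -sqrf_eq0; apply: v00; rewrite mem_index_enum.
Qed.

(** Young's inequality with weight [t]: expand $t(a - b/t)^2 \ge 0$ in each coordinate and sum. *)
Lemma enormD_sqr_le u v (t : R) : 0 < t ->
  enorm (u + v) ^+ 2 <= (1 + t) * enorm u ^+ 2 + (1 + t^-1) * enorm v ^+ 2.
Proof.
move=> t0; rewrite !enorm_sqr !mulr_sumr -big_split/=.
apply: ler_sum => i _; rewrite mxE.
have t1 : t * t^-1 = 1 by rewrite mulfV// gt_eqF.
have : 0 <= t * (u ord0 i - t^-1 * v ord0 i) ^+ 2.
  by rewrite mulr_ge0 ?sqr_ge0// ltW.
set a := u _ _; set b := v _ _.
have -> : t * (a - t^-1 * b) ^+ 2 =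
  t * a ^+ 2 - 2 * (t * t^-1) * a * b + (t * t^-1) * t^-1 * b ^+ 2 by ring.
rewrite t1; nra.
Qed.

Lemma enormD u v : enorm (u + v) <= enorm u + enorm v.
Proof.
have [u0|u0] := eqVneq (enorm u) 0.
  by rewrite (enorm_eq0 u0) add0r enorm0 add0r.
have [v0|v0] := eqVneq (enorm v) 0.
  by rewrite (enorm_eq0 v0) addr0 enorm0 addr0.
have gu : 0 < enorm u by rewrite lt_neqAle eq_sym u0 enorm_ge0.
have gv : 0 < enorm v by rewrite lt_neqAle eq_sym v0 enorm_ge0.
rewrite -ler_sqr ?nnegrE ?addr_ge0 ?enorm_ge0//.
(* [t = |v| / |u|] is the optimal weight. *)
apply: (le_trans (enormD_sqr_le u v (divr_gt0 gv gu))).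
by rewrite le_eqVlt; apply/orP; left; apply/eqP; field; rewrite u0 v0.
Qed.

Lemma enormB_le x y w : enorm (x - w) <= enorm (x - y) + enorm (y - w).
Proof. by rewrite -[x - w](subrKA y); exact: enormD. Qed.

(** The left side is a quadratic polynomial in [t], here interpolated between its values at 0 and 1.
    With [u = x - z i] and [v = z j - z i] it measures the effect of sliding [z i] along the line to
    [z j]; negative [t] slides it away. *)
Lemma enorm_sub_scale u v (t : R) :
  enorm (u - t *: v) ^+ 2 =
  (1 - t) * enorm u ^+ 2 + t * enorm (u - v) ^+ 2
    - t * (1 - t) * enorm v ^+ 2.
Proof.
rewrite !enorm_sqr !mulr_sumr -big_split -sumrB/=; apply: eq_bigr => i _.
by rewrite !mxE; ring.
Qed.

(** The coordinate that realizes the sup-norm is one of the terms under the root. Since [ball]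
    refers to the sup-norm, this puts points that are close in the Euclidean sense into a [ball]. *)
Lemma norm_le_enorm v : `|v| <= enorm v.
Proof.
have [->|v0] := eqVneq v 0; first by rewrite normr0 enorm_ge0.
have /mx_norm_neq0[[i j] /= vE] : mx_norm v != 0.
  by apply: contra_neq v0; exact: mx_norm_eq0.
rewrite [leLHS]vE (ord1 i) -ler_sqr ?nnegrE ?enorm_ge0//.
rewrite enorm_sqr real_normK ?num_real// (bigD1 j)//= lerDl.
by rewrite sumr_ge0// => l _; exact: sqr_ge0.
Qed.

Lemma near_enorm_lt (y : 'rV[R]_N) (d : R) : 0 < d ->
  \forall x \near y, enorm (x - y) < d.
Proof.
move=> d0; have := @enorm_continuous R N y y.
rewrite /continuous_at subrr enorm0.
move/(@cvgrPdist_lt _ _ _ _ (nbhs_filter y)) => /(_ _ d0) h; near=> x.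
have : `|0 - enorm (x - y)| < d by near: x; exact: h.
by rewrite sub0r normrN ger0_norm ?enorm_ge0.
Unshelve. all: by end_near. Qed.

End euclidean_norm.

(** * Distance to a tuple of points *)

Section distance_to_tuple.
Context {R : realType} {N k : nat}.
Implicit Types (z w : 'I_k -> 'rV[R]_N) (x y : 'rV[R]_N).

Lemma edist_set_le z x i : edist_set x (range z) <= enorm (x - z i).
Proof.
apply: ge_inf; last by exists (z i) => //; exists i.
by exists 0 => _ [y _ <-]; exact: enorm_ge0.
Qed.

Hypothesis k_gt0 : (0 < k)%N.

Lemma edist_set_attained z x :
  exists i, edist_set x (range z) = enorm (x - z i).
Proof.
pose i0 := Ordinal k_gt0.
pose i := [arg min_(j < i0) enorm (x - z j)]%O.
have iP j : enorm (x - z i) <= enorm (x - z j).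
  by rewrite /i; case: Order.TotalTheory.arg_minP => // l _; exact.
exists i; apply/eqP; rewrite eq_le edist_set_le/=.
apply: lb_le_inf; first by exists (enorm (x - z i0)), (z i0) => //; exists i0.
by move=> _ [_ [j _ <-] <-].
Qed.

Lemma edist_set_ge0 z x : 0 <= edist_set x (range z).
Proof. by have [i ->] := edist_set_attained z x; exact: enorm_ge0. Qed.

(** The index of a point of [z] nearest to [y] is used as a competitor for [x] and [w], so that the
    point and the tuple can be perturbed at once. *)
Lemma edist_set_lipschitz z w x y (d : R) :
  (forall i, enorm (z i - w i) <= d) ->
  edist_set x (range w) <= edist_set y (range z) + (enorm (x - y) + d).
Proof.
move=> zw; have [i ->] := edist_set_attained z y.
apply: (le_trans (edist_set_le w x i)).
apply: (le_trans (enormB_le _ y _)).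
have := enormB_le y (z i) (w i); have := zw i; lra.
Qed.

Lemma edist_set_continuous z : continuous (edist_set ^~ (range z)).
Proof.
move=> y; apply/(@cvgrPdist_lt _ _ _ _ (nbhs_filter y)) => e e0.
have near_y := near_enorm_lt y e0; near=> x.
have xy : enorm (x - y) < e by near: x; exact: near_y.
have z0 i : enorm (z i - z i) <= 0 by rewrite subrr enorm0.
rewrite ltr_norml; apply/andP; split.
  have := edist_set_lipschitz x y z0; lra.
have := edist_set_lipschitz y x z0; rewrite (enormBC y); lra.
Unshelve. all: by end_near. Qed.

End distance_to_tuple.

(** * Borel measurability *)

Section measurability.
Context {R : realType} {N : nat}.

Lemma measurable_open_rV (U : set 'rV[R]_N) : open U -> measurable U.
Proof. exact: sub_sigma_algebra. Qed.

Lemma continuous_measurable_rV (f : 'rV[R]_N -> R) :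
  continuous f -> measurable_fun setT f.
Proof.
move=> /continuousP cf; apply: (measurability _ (RGenOpens.measurableE R)).
move=> _ [_ [a [b ->] <-]]; rewrite setTI.
by apply: measurable_open_rV; exact/cf/interval_open.
Qed.

(** Pairs carry the product of the two Borel sigma-algebras, so the argument goes through
    projections and coordinates rather than through continuity on the product. *)
Lemma measurable_enorm_sub :
  measurable_fun setT
    (fun p : 'rV[R]_N * 'rV[R]_N => enorm (p.1 - p.2)).
Proof.
have msqrt : measurable_fun setT (@Num.sqrt R).
  by apply: continuous_measurable_fun; exact: sqrt_continuous.
apply: (measurableT_comp msqrt).
apply: measurable_sum => i; apply: measurable_funX.
rewrite [X in measurable_fun _ X](_ : _ =
    fun p : 'rV[R]_N * 'rV[R]_N => p.1 ord0 i - p.2 ord0 i); last first.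
  by apply/funext => p; rewrite !mxE.
have mcoord : measurable_fun setT (fun x : 'rV[R]_N => x ord0 i).
  by apply: continuous_measurable_rV; exact: coord_continuous.
by apply: measurable_funB; apply: (measurableT_comp mcoord).
Qed.

End measurability.

(** * Integrals along couplings, and couplings of small transport cost *)

Section coupling_integrals.
Context {R : realType} {N : nat} {mu nu : probability 'rV[R]_N R}.
Context {rho : probability ('rV[R]_N * 'rV[R]_N)%type R}.
Hypothesis rho_coupling : coupling mu nu rho.
Local Open Scope ereal_scope.

Lemma ge0_integral_coupling_fst (f : 'rV[R]_N -> \bar R) :
  measurable_fun setT f -> (forall x, 0 <= f x) ->
  \int[rho]_p f p.1 = \int[mu]_x f x.
Proof.
move=> mf f0; rewrite -[LHS](@ge0_integral_pushforward _ _ _ _ _ _ _ rho setT)//.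
by apply: eq_measure_integral => A mA _; exact: (rho_coupling mA).1.
Qed.

Lemma ge0_integral_coupling_snd (f : 'rV[R]_N -> \bar R) :
  measurable_fun setT f -> (forall x, 0 <= f x) ->
  \int[rho]_p f p.2 = \int[nu]_x f x.
Proof.
move=> mf f0; rewrite -[LHS](@ge0_integral_pushforward _ _ _ _ _ _ _ rho setT)//.
by apply: eq_measure_integral => A mA _; exact: (rho_coupling mA).2.
Qed.

Lemma integral_coupling_fst (f : 'rV[R]_N -> \bar R) :
  measurable_fun setT f -> rho.-integrable setT (f \o fst) ->
  \int[rho]_p f p.1 = \int[mu]_x f x.
Proof.
move=> mf f0; rewrite -[LHS](@integral_pushforward _ _ _ _ _ _ _ rho setT)//.
by apply: eq_measure_integral => A mA _; exact: (rho_coupling mA).1.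
Qed.

Lemma integral_coupling_snd (f : 'rV[R]_N -> \bar R) :
  measurable_fun setT f -> rho.-integrable setT (f \o snd) ->
  \int[rho]_p f p.2 = \int[nu]_x f x.
Proof.
move=> mf f0; rewrite -[LHS](@integral_pushforward _ _ _ _ _ _ _ rho setT)//.
by apply: eq_measure_integral => A mA _; exact: (rho_coupling mA).2.
Qed.

End coupling_integrals.

(** An infimum below $\sqrt e$ is undercut by some coupling; undoing the square root bounds its
    transport cost by [e]. *)
Lemma wasserstein2_lt (R : realType) (N : nat) (mu nu : probability 'rV[R]_N R)
    (e : R) : (0 < e)%R -> (wasserstein2 mu nu < (Num.sqrt e)%:E)%E ->
  exists2 rho, coupling mu nu rho &
    (\int[rho]_p (enorm (p.1 - p.2) ^+ 2)%:E < e%:E)%E.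
Proof.
move=> e0 /ereal_inf_lt[_ [rho rhoc <-]] h; exists rho => //.
have I0 : (0 <= \int[rho]_p (enorm (p.1 - p.2) ^+ 2)%:E)%E.
  by apply: integral_ge0 => p _; rewrite lee_fin sqr_ge0.
move: h I0; case: (integral _ _ _) => [r|+ _|]//; last first.
  by rewrite poweRyr ?ltNge ?leey// invr_eq0 pnatr_eq0.
by rewrite poweR_EFin !lte_fin lee_fin => + r0; rewrite powR12_sqrt// ltr_sqrt.
Qed.

Lemma integral_cst_probability (d : measure_display) (T : measurableType d)
    (R : realType) (P : probability T R) (c : R) :
  (\int[P]_x c%:E = c%:E)%E.
Proof.
rewrite integral_cst// -[RHS]mule1; congr (_ * _)%E.
exact: probability_setT.
Qed.

Section integral_inequality.
Context {d : measure_display} {T : measurableType d} {R : realType}.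
Variable P : {measure set T -> \bar R}.

(** Young's inequality under the integral. A small [t] keeps the factor of the main term [b] close
    to 1, at the price of a large factor on the error [c]. *)
Lemma integral_sqr_leD (a b c : T -> R) (t : R) : 0 < t ->
  measurable_fun setT a -> measurable_fun setT b -> measurable_fun setT c ->
  (forall x, 0 <= a x) -> (forall x, a x <= b x + c x) ->
  (\int[P]_x (a x ^+ 2)%:E <=
   (1 + t)%:E * \int[P]_x (b x ^+ 2)%:E +
   (1 + t^-1)%:E * \int[P]_x (c x ^+ 2)%:E)%E.
Proof.
move=> t0 ma mb mc a0 abc.
have msq (f : T -> R) : measurable_fun setT f ->
    measurable_fun setT (fun x => (f x ^+ 2)%:E).
  by move=> mf; apply/measurable_EFinP; exact: measurable_funX.
have t1 : 0 <= 1 + t by rewrite addr_ge0// ltW.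
have t2 : 0 <= 1 + t^-1 by rewrite addr_ge0// invr_ge0 ltW.
rewrite -!ge0_integralZl_EFin//; [|by move=> x _; rewrite lee_fin sqr_ge0
  |exact: msq|by move=> x _; rewrite lee_fin sqr_ge0|exact: msq].
rewrite -ge0_integralD//; first last.
- by apply: measurable_funeM; exact: msq.
- by move=> x _; rewrite -EFinM lee_fin mulr_ge0// sqr_ge0.
- by apply: measurable_funeM; exact: msq.
- by move=> x _; rewrite -EFinM lee_fin mulr_ge0// sqr_ge0.
apply: ge0_le_integral => //.
- by move=> x _; rewrite lee_fin sqr_ge0.
- exact: msq.
- by apply: emeasurable_funD; apply: measurable_funeM; exact: msq.
move=> x _; rewrite -!EFinM -EFinD lee_fin.
have tt : t * t^-1 = 1 by rewrite mulfV// gt_eqF.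
have le2 : a x ^+ 2 <= (b x + c x) ^+ 2 by have := a0 x; have := abc x; nra.
have : 0 <= t * (b x - t^-1 * c x) ^+ 2 by rewrite mulr_ge0 ?sqr_ge0// ltW.
have -> : t * (b x - t^-1 * c x) ^+ 2 = t * b x ^+ 2
  - 2 * (t * t^-1) * b x * c x + (t * t^-1) * t^-1 * c x ^+ 2 by ring.
rewrite tt; nra.
Qed.

End integral_inequality.

(** * The quantization cost: finiteness, stability under couplings, limits of minimizers *)

Section quantization_cost.
Context {R : realType} {N k : nat}.
Implicit Types (z w : 'I_k -> 'rV[R]_N) (mu : probability 'rV[R]_N R).
Hypothesis k_gt0 : (0 < k)%N.

Lemma measurable_edist z :
  measurable_fun setT (fun x : 'rV[R]_N => edist_set x (range z)).
Proof. by apply: continuous_measurable_rV; exact: edist_set_continuous. Qed.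

Lemma measurable_edist_sqr z :
  measurable_fun setT (fun x : 'rV[R]_N => (edist_set x (range z) ^+ 2)%:E).
Proof.
by apply/measurable_EFinP; apply: measurable_funX; exact: measurable_edist.
Qed.

Lemma measurable_enorm_subr (a : 'rV[R]_N) :
  measurable_fun setT (fun x : 'rV[R]_N => enorm (x - a)).
Proof. by apply: continuous_measurable_rV; exact: enorm_continuous. Qed.

Lemma quantization_cost_ge0 mu z : (0 <= quantization_cost mu z)%E.
Proof. by apply: integral_ge0 => x _; rewrite lee_fin sqr_ge0. Qed.

Lemma quantization_cost_lty mu z :
  finite_second_moment mu -> (quantization_cost mu z < +oo)%E.
Proof.
move=> mu2; pose a := z (Ordinal k_gt0).
apply: (@le_lt_trans _ _ ((1 + 1)%:E * \int[mu]_x (enorm x ^+ 2)%:E +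
    (1 + 1^-1)%:E * \int[mu]_x (enorm a ^+ 2)%:E)%E).
  apply: integral_sqr_leD => //.
  - exact: measurable_edist.
  - rewrite [X in measurable_fun _ X](_ : _ = fun x => enorm (x - 0)).
      exact: measurable_enorm_subr.
    by apply/funext => x; rewrite subr0.
  - by move=> x; exact: edist_set_ge0.
  move=> x; apply: (le_trans (edist_set_le _ _ (Ordinal k_gt0))).
  by apply: (le_trans (enormD _ _)); rewrite enormN.
rewrite integral_cst_probability; apply: lte_add_pinfty.
  by rewrite lte_mul_pinfty// lee_fin.
by rewrite -EFinM ltry.
Qed.

Section perturbation.
Context {d : measure_display} {T : measurableType d} {P : probability T R}.

(** Stability of the cost, with [X] and [Y] meant as the two projections of a coupling. The distance
    from [Y] to [w] exceeds that from [X] to [z] by at most $|Y - X| + dl$; Young's inequality is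
    applied with weight [t] to split off this error and with weight 1 inside it. *)
Lemma cost_perturbation (X Y : T -> 'rV[R]_N) z w (C I dl t : R) :
  measurable_fun setT X -> measurable_fun setT Y ->
  measurable_fun setT (fun s => enorm (Y s - X s)) ->
  0 < t -> 0 <= dl -> (forall i, enorm (z i - w i) <= dl) ->
  (\int[P]_s (edist_set (X s) (range z) ^+ 2)%:E <= C%:E)%E ->
  (\int[P]_s (enorm (Y s - X s) ^+ 2)%:E <= I%:E)%E ->
  (\int[P]_s (edist_set (Y s) (range w) ^+ 2)%:E <=
   ((1 + t) * C + (1 + t^-1) * (2 * I + 2 * dl ^+ 2))%:E)%E.
Proof.
move=> mX mY mYX t0 dl0 zw hC hI.
have mXz : measurable_fun setT (fun s => edist_set (X s) (range z)).
  exact: (measurableT_comp (measurable_edist z) mX).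
have mYw : measurable_fun setT (fun s => edist_set (Y s) (range w)).
  exact: (measurableT_comp (measurable_edist w) mY).
have hD : (\int[P]_s ((enorm (Y s - X s) + dl) ^+ 2)%:E <=
    (2 * I + 2 * dl ^+ 2)%:E)%E.
  apply: (@le_trans _ _ ((1 + 1)%:E * \int[P]_s (enorm (Y s - X s) ^+ 2)%:E +
      (1 + 1^-1)%:E * \int[P]_s (dl ^+ 2)%:E)%E).
    apply: integral_sqr_leD => //.
    - by apply: measurable_funD.
    - by move=> s; rewrite addr_ge0// enorm_ge0.
  rewrite invr1 integral_cst_probability [leRHS]EFinD; apply: leeD.
    by rewrite [leRHS]EFinM; apply: lee_wpmul2l; rewrite ?lee_fin.
  by rewrite -EFinM.
apply: (@le_trans _ _
  ((1 + t)%:E * \int[P]_s (edist_set (X s) (range z) ^+ 2)%:E +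
   (1 + t^-1)%:E * \int[P]_s ((enorm (Y s - X s) + dl) ^+ 2)%:E)%E).
  apply: integral_sqr_leD => //.
  - by apply: measurable_funD.
  - by move=> s; exact: edist_set_ge0.
  - by move=> s; exact: edist_set_lipschitz.
have t1 : 0 <= 1 + t by rewrite addr_ge0// ltW.
have t2 : 0 <= 1 + t^-1 by rewrite addr_ge0// invr_ge0 ltW.
by rewrite [leRHS]EFinD; apply: leeD; rewrite [leRHS]EFinM;
  apply: lee_wpmul2l; rewrite ?lee_fin.
Qed.

End perturbation.

Lemma enorm_cvg0 (u : nat -> 'rV[R]_N) (a : 'rV[R]_N) (e : R) : 0 < e ->
  u m @[m --> \oo] --> a -> \forall m \near \oo, enorm (u m - a) < e.
Proof.
move=> e0 ua.
have : enorm (u m - a) @[m --> \oo] --> enorm (a - a).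
  exact: cvg_comp ua (@enorm_continuous R N a a).
rewrite subrr enorm0 => /cvgrPdist_lt/(_ _ e0); apply: filterS => m.
by rewrite sub0r normrN ger0_norm// enorm_ge0.
Qed.

(** The cost of a competitor [w] is carried from [mu] to [mu_ m] along a coupling, compared there
    with that of [z_ m], and the latter is carried back to [mu] and [z]. For a prescribed error [e],
    one late [m] suffices. *)
Lemma is_minimizer_limit (mu_ : nat -> probability 'rV[R]_N R) mu
    (z_ : nat -> 'I_k -> 'rV[R]_N) z :
  finite_second_moment mu ->
  wasserstein2 (mu_ m) mu @[m --> \oo] --> 0%E ->
  (forall m, is_minimizer (mu_ m) (z_ m)) ->
  (forall i, z_ m i @[m --> \oo] --> z i) ->
  is_minimizer mu z.
Proof.
move=> mu2 W0 zmin zcvg w.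
have [W WE] : exists W, quantization_cost mu w = W%:E.
  exists (fine (quantization_cost mu w)); rewrite fineK// ge0_fin_numE.
    exact: quantization_cost_lty.
  exact: quantization_cost_ge0.
have W_ge0 : 0 <= W by rewrite -lee_fin -WE quantization_cost_ge0.
rewrite WE; apply/lee_addgt0Pr => e e0.
(* With $q = 1 + 1/t$ the two passages yield $(1+t)^2 W + 2(1+t)q\,eta + 4q\,eta$. As $t \le 1$,
   this is at most $W + 3tW + 8q\,eta$, and the constants 6 and 16 make each excess at most
   [e / 2]. *)
pose t := Num.min 1 (e / (6 * (W + 1))).
have W1 : 0 < 6 * (W + 1) by lra.
have t0 : 0 < t by rewrite lt_min ltr01 divr_gt0.
have t1 : t <= 1 by rewrite ge_min lexx.
have tW : 6 * (W + 1) * t <= e.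
  by rewrite mulrC -ler_pdivlMr// ge_min lexx orbT.
have it0 : 0 < 1 + t^-1 by rewrite addr_gt0// invr_gt0.
pose eta := e / (16 * (1 + t^-1)).
have eta0 : 0 < eta by rewrite divr_gt0// mulr_gt0.
have etaE : 16 * (1 + t^-1) * eta = e.
  by rewrite /eta mulrC divfK// gt_eqF// mulr_gt0.
have seta0 : 0 < Num.sqrt eta by rewrite sqrtr_gt0.
have [m [Wm zm]] : exists m, (wasserstein2 (mu_ m) mu < (Num.sqrt eta)%:E)%E /\
    forall i, enorm (z_ m i - z i) < Num.sqrt eta.
  near \oo => m; exists m; split; near: m.
    by apply: (W0 _ (open_ereal_lt' _)); rewrite lte_fin.
  by apply: filter_forall => i; exact: enorm_cvg0.
have [rho rhoc rhoI] := wasserstein2_lt eta0 Wm.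
have mfst : measurable_fun setT (@fst 'rV[R]_N 'rV[R]_N) by [].
have msnd : measurable_fun setT (@snd 'rV[R]_N 'rV[R]_N) by [].
have wm : (quantization_cost (mu_ m) w <=
    ((1 + t) * W + (1 + t^-1) * (2 * eta))%:E)%E.
  (* The tuple [w] stays the same in this passage, hence a displacement [dl] equal to 0. *)
  have -> : 2 * eta = 2 * eta + 2 * 0 ^+ 2 by rewrite expr0n mulr0 addr0.
  rewrite /quantization_cost -(ge0_integral_coupling_fst rhoc); last 2 first.
  - exact: measurable_edist_sqr.
  - by move=> x; rewrite lee_fin sqr_ge0.
  apply: (cost_perturbation (z := w) msnd mfst) => //.
  - exact: measurable_enorm_sub.
  - by move=> i; rewrite subrr enorm0.
  - rewrite (ge0_integral_coupling_snd rhoc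
        (f := fun y => (edist_set y (range w) ^+ 2)%:E))
      -/(quantization_cost _ _) ?WE//.
    + exact: measurable_edist_sqr.
    + by move=> x; rewrite lee_fin sqr_ge0.
  - exact: ltW.
have {}wm := le_trans (zmin m w) wm.
rewrite /quantization_cost -(ge0_integral_coupling_snd rhoc); last 2 first.
- exact: measurable_edist_sqr.
- by move=> x; rewrite lee_fin sqr_ge0.
apply: le_trans; first apply: (cost_perturbation (z := z_ m)
  (dl := Num.sqrt eta) mfst msnd _ t0).
- rewrite [X in measurable_fun _ X](_ : _ = fun p => enorm (p.1 - p.2)).
    exact: measurable_enorm_sub.
  by apply/funext => p; rewrite enormBC.
- exact: ltW.
- by move=> i; exact: ltW.
- rewrite (ge0_integral_coupling_fst rhoc
    (f := fun y => (edist_set y (range (z_ m)) ^+ 2)%:E)).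
  + exact: wm.
  + exact: measurable_edist_sqr.
  + by move=> x; rewrite lee_fin sqr_ge0.
- under eq_integral do rewrite enormBC.
  exact: ltW rhoI.
rewrite -EFinD lee_fin sqr_sqrtr ?ltW//.
set q := 1 + t^-1 in it0 etaE *.
have qeta0 : 0 <= q * eta by apply: mulr_ge0; exact: ltW.
have : 0 <= t * (q * eta) by rewrite mulr_ge0// ltW.
have : t * (q * eta) <= q * eta by rewrite ler_piMl.
have : t * t * W <= t * W by rewrite ler_wpM2r// ler_piMl// ltW.
have : 0 <= t by exact: ltW.
nra.
Unshelve. all: by end_near. Qed.

End quantization_cost.

(** The finite integral of [f] cancels, so the nonnegative function [g - f] has integral zero and
    vanishes almost everywhere, whereas it is positive on [U]. *)
Lemma integral_le_strict_measure0 (d : measure_display) (T : measurableType d)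
    (R : realType) (mu : {measure set T -> \bar R}) (f g : T -> R) (U : set T) :
  measurable_fun setT f -> measurable_fun setT g -> measurable U ->
  (forall x, 0 <= f x <= g x) -> (forall x, U x -> f x < g x) ->
  (\int[mu]_x (f x)%:E < +oo)%E ->
  (\int[mu]_x (g x)%:E <= \int[mu]_x (f x)%:E)%E -> mu U = 0%E.
Proof.
move=> mf mg mU fg fgU foo gf.
pose h x := g x - f x.
have mh : measurable_fun setT h by exact: measurable_funB.
have h0 x : 0 <= h x by rewrite subr_ge0; case/andP: (fg x).
have f0 x : 0 <= f x by case/andP: (fg x).
have I0 : (0 <= \int[mu]_x (f x)%:E)%E.
  by apply: integral_ge0 => x _; rewrite lee_fin.
have H0 : (0 <= \int[mu]_x (h x)%:E)%E.
  by apply: integral_ge0 => x _; rewrite lee_fin.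
have gE : (\int[mu]_x (g x)%:E = \int[mu]_x (f x)%:E + \int[mu]_x (h x)%:E)%E.
  rewrite -ge0_integralD//; first last.
  - exact/measurable_EFinP.
  - by move=> x _; rewrite lee_fin.
  - exact/measurable_EFinP.
  - by move=> x _; rewrite lee_fin.
  by apply: eq_integral => x _; rewrite -EFinD addrC subrK.
have hI0 : (\int[mu]_x `|(h x)%:E| = 0)%E.
  under eq_integral do rewrite gee0_abs ?lee_fin//.
  apply/eqP; rewrite eq_le H0 andbT.
  move: gf; rewrite gE -[leRHS]adde0 leeD2lE//.
  by rewrite ge0_fin_numE.
have mhE : measurable_fun setT (EFin \o h) by exact/measurable_EFinP.
have [A [mA A0 hA]] := (ae_eq_integral_abs mu measurableT mhE).1 hI0.
apply: (subset_measure0 mU mA _ A0) => x Ux; apply: hA => /= /(_ I) [hx0].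
by have := fgU _ Ux; rewrite -subr_gt0 -/(h x) hx0 ltxx.
Qed.

(** * Minimizers have distinct points and null cell boundaries *)

Section minimizers.
Context {R : realType} {N k : nat}.
Implicit Types (z w : 'I_k -> 'rV[R]_N).
Variable mu : probability 'rV[R]_N R.
Hypothesis k_gt0 : (0 < k)%N.
Hypothesis mu2 : finite_second_moment mu.

Definition move_point z (i : 'I_k) (p : 'rV[R]_N) : 'I_k -> 'rV[R]_N :=
  fun j => if j == i then p else z j.

Lemma edist_move_point_le z i p x l : l != i ->
  edist_set x (range (move_point z i p)) <= enorm (x - z l).
Proof.
move=> li; have := edist_set_le (move_point z i p) x l.
by rewrite /move_point (negbTE li).
Qed.

Lemma edist_move_point_new z i p x :
  edist_set x (range (move_point z i p)) <= enorm (x - p).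
Proof.
by have := edist_set_le (move_point z i p) x i; rewrite /move_point eqxx.
Qed.

(* If [z i = z j], moving [z j] to a point of the support outside [range z]
   strictly decreases the cost. *)
Lemma minimizer_injective z :
  [set: 'I_k] #<= supp mu -> is_minimizer mu z -> injective z.
Proof.
move=> /pcard_leP[f] zmin.
have [[l fl]|fz] := pselect (exists l, forall i, z i != f l); last first.
  (* If every [f l] is hit by [z], choosing preimages gives an injective self-map [g] of a finite
     type. It is bijective, and [z] inherits injectivity from [f]. *)
  have gP l : exists i, z i = f l.
    apply: contra_notP fz => zl; exists l => i; apply/eqP => zil.
    by apply: zl; exists i.
  pose g l := sval (cid (gP l)).
  have gE l : z (g l) = f l := svalP (cid (gP l)).
  have finj : injective f.
    by move=> a b fab; apply: (@inj _ _ _ f); rewrite ?inE.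
  have ginj : injective g by move=> a b gab; apply: finj; rewrite -!gE gab.
  move=> i j zij; have [h gh hg] := injF_bij ginj.
  by rewrite -(hg i) -(hg j); congr g; apply: finj; rewrite -!gE !hg.
move=> i j zij; apply/eqP/negPn/negP => ij; exfalso.
set p := f l in fl.
pose w := move_point z j p.
(* On [U] the new point [p] strictly improves the distance. As an open neighbourhood of a support
   point, [U] has positive measure, which optimality contradicts. *)
pose U := [set x | enorm (x - p) < edist_set x (range z)].
have oU : open U.
  have c : continuous
      (fun x : 'rV[R]_N => edist_set x (range z) - enorm (x - p)).
    move=> x; exact: (cvgB (@edist_set_continuous _ _ _ k_gt0 z x)
      (@enorm_continuous _ _ p x)).
  have -> : U = (fun x => edist_set x (range z) - enorm (x - p)) @^-1`
      [set r | 0 < r].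
    by apply/seteqP; split => x /=; rewrite subr_gt0.
  by move/continuousP: c; apply; exact: open_gt.
have Up : U p.
  have [a /= pa] := edist_set_attained k_gt0 z p.
  rewrite /U/= subrr enorm0 pa lt_neqAle enorm_ge0 andbT eq_sym.
  apply/eqP => /enorm_eq0/eqP; rewrite subr_eq0 eq_sym; exact/negP.
have /(_ U oU Up) : supp mu p := @funS _ _ _ _ f l Logic.I.
apply/negP; rewrite -leNgt.
have ed0 (v : 'I_k -> 'rV[R]_N) x : 0 <= edist_set x (range v) :=
  edist_set_ge0 k_gt0 v x.
have wz x : edist_set x (range w) <= edist_set x (range z).
  have [a ->] := edist_set_attained k_gt0 z x.
  have [->|aj] := eqVneq a j; last exact: edist_move_point_le.
  (* The twin [z i] remains in place when [z j] leaves. *)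
  by rewrite -zij; exact: edist_move_point_le.
rewrite (@integral_le_strict_measure0 _ _ _ mu
  (fun x => edist_set x (range w) ^+ 2)
  (fun x => edist_set x (range z) ^+ 2) U)//.
- by apply: measurable_funX; exact: measurable_edist.
- by apply: measurable_funX; exact: measurable_edist.
- exact: measurable_open_rV.
- by move=> x; rewrite sqr_ge0 ler_sqr ?nnegrE ?ed0 ?wz.
- move=> x Ux; rewrite ltr_sqr ?nnegrE ?ed0//.
  exact: le_lt_trans (edist_move_point_new z j p x) Ux.
- exact: quantization_cost_lty.
- exact: zmin.
Qed.

(* Moving [z i] by [t v] and by [- t v], where [v = z j - z i], beats [z] on
   average by [t |v|^2 / 2] on the common boundary, where [<x - z i, v>] equals
   [|v|^2 / 2], and costs at most [t^2 |v|^2] elsewhere. *)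
Lemma edist_move_boundary z i j (t : R) v x :
  i != j -> 0 <= t -> v = z j - z i ->
  edist_set x (range (move_point z i (z i + t *: v))) ^+ 2 +
  (edist_set x (range (move_point z i (z i - t *: v))) ^+ 2 +
   t * enorm v ^+ 2 * \1_(voronoi z i `&` voronoi z j) x) <=
  edist_set x (range z) ^+ 2 +
  (edist_set x (range z) ^+ 2 + 2 * t ^+ 2 * enorm v ^+ 2).
Proof.
move=> ij t0 vE; rewrite indicE.
set w1 := move_point _ _ _; set w2 := move_point _ _ _.
have ed0 (u : 'I_k -> 'rV[R]_N) : 0 <= edist_set x (range u) :=
  edist_set_ge0 k_gt0 u x.
have sq (u : 'I_k -> 'rV[R]_N) b : edist_set x (range u) <= b ->
    edist_set x (range u) ^+ 2 <= b ^+ 2.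
  by move=> h; rewrite ler_sqr// nnegrE ?ed0 ?(le_trans (ed0 u) h).
have v2 := sqr_ge0 (enorm v); have tv : 0 <= t ^+ 2 * enorm v ^+ 2.
  by rewrite mulr_ge0// sqr_ge0.
have E s : enorm (x - (z i + s *: v)) ^+ 2 = (1 - s) * enorm (x - z i) ^+ 2
    + s * enorm (x - z j) ^+ 2 - s * (1 - s) * enorm v ^+ 2.
  have -> : x - z j = x - z i - v by rewrite vE opprB addrA subrK.
  by rewrite opprD addrA enorm_sub_scale.
have w1i : edist_set x (range w1) ^+ 2 <= enorm (x - (z i + t *: v)) ^+ 2.
  by apply: sq; exact: edist_move_point_new.
have w2i : edist_set x (range w2) ^+ 2 <= enorm (x - (z i + (- t) *: v)) ^+ 2.
  by apply: sq; rewrite scaleNr; exact: edist_move_point_new.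
have [xi|xi] := pselect (voronoi z i x); last first.
  rewrite memNset ?mulr0n ?mulr0 ?addr0; last by case.
  (* Off the cell of [z i], a nearest point has another index and does not move. *)
  have [l xl] := edist_set_attained k_gt0 z x.
  have li : l != i by apply: contra_notN xi => /eqP li; rewrite /voronoi/= xl li.
  have h1 : edist_set x (range w1) ^+ 2 <= edist_set x (range z) ^+ 2.
    by apply: sq; rewrite xl; exact: edist_move_point_le.
  have h2 : edist_set x (range w2) ^+ 2 <= edist_set x (range z) ^+ 2.
    by apply: sq; rewrite xl; exact: edist_move_point_le.
  lra.
have [xj|xj] := pselect (voronoi z j x); last first.
  rewrite memNset ?mulr0n ?mulr0 ?addr0; last by case.
  (* The terms linear in [t] cancel between [t] and [- t], leaving the excess $2t^2|v|^2$. *)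
  rewrite E in w1i; rewrite E in w2i; rewrite xi; nra.
(* On the boundary, [z j] replaces [z i] when the latter moves away, so [w2] loses nothing, while
   [w1] gains $t(1-t)|v|^2$. *)
rewrite mem_set// mulr1.
have h2 : edist_set x (range w2) ^+ 2 <= edist_set x (range z) ^+ 2.
  by apply: sq; rewrite xj; apply: edist_move_point_le; rewrite eq_sym.
rewrite E -xi -xj in w1i; nra.
Qed.

(** Integrating the pointwise inequality and using optimality against both moves leaves
    $t|v|^2\mu(A) \le 2t^2|v|^2$, that is $\mu(A) \le 2t$ for every $t > 0$. *)
Lemma minimizer_boundary_null z i j : is_minimizer mu z -> z i != z j ->
  mu (voronoi z i `&` voronoi z j) = 0%E.
Proof.
move=> zmin zij; set A := _ `&` _.
have mA : measurable A by apply: measurableI; exact: measurable_voronoi.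
have ij : i != j by apply: contra_neq zij => ->.
pose v := z j - z i.
have v0 : 0 < enorm v ^+ 2.
  rewrite exprn_gt0// lt_neqAle enorm_ge0 andbT eq_sym; apply: contra_neq zij.
  by move=> /enorm_eq0/subr0_eq.
have finc (u : 'I_k -> 'rV[R]_N) :
    exists2 r, 0 <= r & quantization_cost mu u = r%:E.
  have ge0 := quantization_cost_ge0 mu u.
  have lty := quantization_cost_lty k_gt0 u mu2.
  by exists (fine (quantization_cost mu u));
    rewrite ?fine_ge0// fineK// ge0_fin_numE.
have [a a0 aE] : exists2 r, 0 <= r & mu A = r%:E.
  by exists (fine (mu A)); rewrite ?fine_ge0// fineK// fin_num_measure.
rewrite aE; congr (_%:E); apply/eqP; rewrite eq_le a0 andbT.
apply/ler_addgt0Pr => e e0; rewrite add0r.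
pose t := e / 2; have t0 : 0 < t by rewrite divr_gt0.
pose w1 := move_point z i (z i + t *: v).
pose w2 := move_point z i (z i - t *: v).
have [f _ fE] := finc z; have [f1 _ f1E] := finc w1; have [f2 _ f2E] := finc w2.
have le1 : f <= f1 by rewrite -lee_fin -fE -f1E; exact: zmin.
have le2 : f <= f2 by rewrite -lee_fin -fE -f2E; exact: zmin.
have me (u : 'I_k -> 'rV[R]_N) := measurable_edist_sqr k_gt0 u.
have e0' (u : 'I_k -> 'rV[R]_N) x :
    (0 <= (edist_set x (range u) ^+ 2)%:E)%E.
  by rewrite lee_fin sqr_ge0.
pose c := t * enorm v ^+ 2.
have c0 : 0 <= c by rewrite mulr_ge0// ltW.
have mI : measurable_fun setT (fun x => (c * \1_A x)%:E).
  by apply/measurable_EFinP; exact: measurable_funM.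
have I0 x : (0 <= (c * \1_A x)%:E)%E by rewrite lee_fin mulr_ge0.
(* All summands on both sides are nonnegative, so each integral splits by [ge0_integralD]. *)
have key : (\int[mu]_x ((edist_set x (range w1) ^+ 2)%:E +
   ((edist_set x (range w2) ^+ 2)%:E + (c * \1_A x)%:E)) <=
   \int[mu]_x ((edist_set x (range z) ^+ 2)%:E +
     ((edist_set x (range z) ^+ 2)%:E + (2 * t ^+ 2 * enorm v ^+ 2)%:E)))%E.
  apply: ge0_le_integral => //.
  - by move=> x _; rewrite !adde_ge0.
  - by apply: emeasurable_funD => //; exact: emeasurable_funD.
  - by apply: emeasurable_funD => //; exact: emeasurable_funD.
  - move=> x _; rewrite -!EFinD lee_fin; apply: edist_move_boundary => //.
    exact: ltW.
have tv0 : 0 <= 2 * t ^+ 2 * enorm v ^+ 2.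
  by rewrite mulr_ge0 ?sqr_ge0// mulr_ge0 ?sqr_ge0.
have cA : (\int[mu]_x (c * \1_A x)%:E = (c * a)%:E)%E.
  under eq_integral do rewrite EFinM.
  rewrite ge0_integralZl_EFin//; last exact/measurable_EFinP/measurable_indic.
  by rewrite integral_indic// setIT [RHS]EFinM; congr (_ * _)%E; exact: aE.
move: key; rewrite !ge0_integralD//; first last.
- exact: emeasurable_funD.
- by move=> x _; rewrite adde_ge0.
- exact: emeasurable_funD.
- by move=> x _; rewrite adde_ge0// lee_fin.
rewrite cA (integral_cst_probability mu).
rewrite -![integral _ _ (fun x => (edist_set _ _ ^+ 2)%:E)]
  /(quantization_cost mu _).
rewrite fE f1E f2E -!EFinD lee_fin => key.
have h : c * a <= 2 * t * c.
  have -> : 2 * t * c = 2 * t ^+ 2 * enorm v ^+ 2 by rewrite /c; ring.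
  by clear -key le1 le2; lra.
have c1 : 0 < c by rewrite mulr_gt0.
have : a <= 2 * t by rewrite mulrC ler_pM2r in h.
by rewrite /t mulrCA mulfV// mulr1.
Qed.

End minimizers.

(** * Bounded integrands and restricted measures *)

Section bounded_integrals.
Context {d : measure_display} {T : measurableType d} {R : realType}.

Lemma integrable_le_cst (mu : {measure set T -> \bar R}) (f : T -> R) (M : R) :
  (mu setT < +oo)%E -> measurable_fun setT f -> (forall x, `|f x| <= M) ->
  mu.-integrable setT (EFin \o f).
Proof.
move=> mufin mf fM; apply: measurable_bounded_integrable => //.
exists M; split; first exact: num_real.
by move=> B MB x _; apply: le_trans (fM x) _; exact: ltW.
Qed.

Lemma abse_integralB_le (mu : {measure set T -> \bar R}) (f g h : T -> R) :
  mu.-integrable setT (EFin \o f) -> mu.-integrable setT (EFin \o g) ->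
  measurable_fun setT h -> (forall x, `|f x - g x| <= h x) ->
  (`|\int[mu]_x (f x)%:E - \int[mu]_x (g x)%:E| <= \int[mu]_x (h x)%:E)%E.
Proof.
move=> fi gi mh fgh; rewrite -integralB_EFin//.
have mfg : measurable_fun setT (fun x => (f x)%:E - (g x)%:E)%E.
  by apply: emeasurable_funB; [exact: measurable_int fi|exact: measurable_int gi].
apply: le_trans; first exact: le_abse_integral.
apply: ge0_le_integral => //.
- exact: measurableT_comp.
- exact/measurable_EFinP.
- by move=> x _; rewrite -EFinB abse_EFin lee_fin.
Qed.

(** The complement of [D] is null for [mrestr mu mD], and the two measures agree on subsets of
    [D]. *)
Lemma integral_mrestr (mu : {measure set T -> \bar R}) (D : set T)
    (mD : measurable D) (f : T -> R) :
  (mrestr mu mD).-integrable setT (EFin \o f) ->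
  (\int[mrestr mu mD]_x (f x)%:E = \int[mu]_x (f x * \1_D x)%:E)%E.
Proof.
move=> fi; transitivity (\int[mrestr mu mD]_(x in setT `\` ~` D) (f x)%:E)%E.
  apply: negligible_integral => //; first exact: measurableC.
  by rewrite /= /mrestr setICl measure0.
rewrite setTD setCK; transitivity (\int[mu]_(x in D) (f x)%:E)%E.
  by apply: eq_measure_integral => A mA AD; rewrite /= /mrestr setIidl.
rewrite integral_mkcond; apply: eq_integral => x _.
by rewrite patchE indicE; case: ifP => _; rewrite ?mulr1// mulr0.
Qed.

End bounded_integrals.

(** * Extended continuous mapping along couplings *)

Section convergence_along_couplings.
Context {R : realType} {N : nat}.
Variables (mu_ : nat -> probability 'rV[R]_N R) (mu : probability 'rV[R]_N R).
Variables (g_ : nat -> 'rV[R]_N -> R) (g : 'rV[R]_N -> R) (M : R).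
Hypothesis mg_ : forall m, measurable_fun setT (g_ m).
Hypothesis mg : measurable_fun setT g.
Hypothesis g_M : forall m x, `|g_ m x| <= M.
Hypothesis gM : forall x, `|g x| <= M.

Let value_at n x a := a = g x \/ exists2 m, (n <= m)%N & a = g_ m x.

(* The points around which the functions [g] and [g_ m], [n <= m], jointly
   oscillate by more than [e]; these sets are open, hence measurable. *)
Definition oscillation_set (e : R) (n : nat) : set 'rV[R]_N :=
  [set y | exists x x' a a', [/\ ball y n.+1%:R^-1 x, ball y n.+1%:R^-1 x',
     value_at n x a, value_at n x' a' & e < `|a - a'|]].

(** The same witnesses serve all nearby centres, because balls are open and symmetric. *)
Lemma open_oscillation_set e n : open (oscillation_set e n).
Proof.
rewrite openE => y [x [x' [a [a' [yx yx' va va' aa']]]]].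
have r0 : 0 < n.+1%:R^-1 :> R by rewrite invr_gt0.
have nx u : ball y n.+1%:R^-1 u -> \forall v \near y, ball v n.+1%:R^-1 u.
  move=> /ball_sym yu.
  apply: (@filterS _ _ (nbhs_filter y) (ball u n.+1%:R^-1)).
    by move=> v; exact: ball_sym.
  by apply: open_nbhs_nbhs; split => //; exact: ball_open.
rewrite /interior; near=> v; exists x, x', a, a'; split => //; near: v; exact: nx.
Unshelve. all: by end_near. Qed.

Lemma subset_oscillation_set e m n : (m <= n)%N ->
  oscillation_set e n `<=` oscillation_set e m.
Proof.
move=> mn y [x [x' [a [a' [yx yx' va va' aa']]]]].
have rle : n.+1%:R^-1 <= m.+1%:R^-1 :> R by rewrite lef_pV2 ?posrE// ler_nat.
have V u b : value_at n u b -> value_at m u b.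
  by case=> [->|[l nl ->]]; [left|right; exists l => //; exact: leq_trans nl].
exists x, x', a, a'; split; [| |exact: V|exact: V|by []].
  exact: le_ball yx.
exact: le_ball yx'.
Qed.

(** This is continuous convergence of [g_ m] to [g] at almost every point, where [g] is also
    continuous; one neighbourhood serves all [m >= n]. *)
Hypothesis g_cvg : {ae mu, forall y, forall e, 0 < e -> exists n,
  \forall x \near y, `|g x - g y| <= e /\
    forall m, (n <= m)%N -> `|g_ m x - g y| <= e}.

(** A point of all these sets violates the convergence hypothesis, so their intersection is null;
    continuity from above of the finite measure [mu] concludes. *)
Lemma oscillation_set_cvg0 (e c : R) : 0 < e -> 0 < c ->
  exists n, (mu (oscillation_set e n) < c%:E)%E.
Proof.
move=> e0 c0; have [E [mE E0 cE]] := g_cvg.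
have mO n : measurable (oscillation_set e n).
  by apply: measurable_open_rV; exact: open_oscillation_set.
have mI : measurable (\bigcap_n oscillation_set e n) by exact: bigcapT_measurable.
have I0 : mu (\bigcap_n oscillation_set e n) = 0%E.
  apply: (subset_measure0 mI mE _ E0) => y Oy; apply: cE => /= Hy.
  (* Two values within [e / 2] of [g y] differ by at most [e]. *)
  have [n /nbhs_ballP[r /= r0 yr]] := Hy _ (divr_gt0 e0 (ltr0n R 2)).
  have [l lr] : exists l, l.+1%:R^-1 < r.
    near \oo => l; exists l; near: l; exact: near_infty_natSinv_lt (PosNum r0).
  have [x [x' [a [a' [yx yx' va va' aa']]]]] := Oy (maxn n l) Logic.I.
  have bd u b : ball y (maxn n l).+1%:R^-1 u -> value_at (maxn n l) u b ->
      `|b - g y| <= e / 2.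
    move=> yu vb; have yru : ball y r u.
      apply: le_ball yu; apply: le_trans (ltW lr).
      by rewrite lef_pV2 ?posrE// ler_nat ltnS leq_maxr.
    have [h1 h2] := yr _ yru; case: vb => [->//|[m nm ->]].
    by apply: h2; apply: leq_trans nm; exact: leq_maxl.
  have := bd _ _ yx va; have := bd _ _ yx' va'; have := ler_distD (g y) a a'.
  rewrite (distrC (g y) a'); lra.
have h : mu (oscillation_set e n) @[n --> \oo] -->
    mu (\bigcap_n oscillation_set e n).
  apply: nonincreasing_cvg_mu => //.
    by apply: (@le_lt_trans _ _ 1%E); [exact: probability_le1|rewrite ltry].
  by move=> m n mn; apply/subsetPset; exact: subset_oscillation_set.
rewrite I0 in h.
near \oo => n; exists n; near: n.
by apply: (h _ (open_ereal_lt' _)); rewrite lte_fin.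
Unshelve. all: by end_near. Qed.

(** Either [y] is an oscillation point, where the trivial bound [2 * M] applies; or [x] lies in the
    small ball around [y], and the difference is at most [e]; or $(n+1)|x-y| \ge 1$, and the last
    term dominates [2 * M] as in Chebyshev's inequality. *)
Lemma value_dist_le e n m x y : 0 <= e -> (n <= m)%N ->
  `|g_ m x - g y| <= e + 2 * M * \1_(oscillation_set e n) y +
    2 * M * n.+1%:R ^+ 2 * enorm (x - y) ^+ 2.
Proof.
move=> e0 nm.
have M0 : 0 <= M := le_trans (normr_ge0 _) (gM y).
have d2M : `|g_ m x - g y| <= 2 * M.
  apply: le_trans (ler_normB _ _) _; have := g_M m x; have := gM y; lra.
have n0 : 0 < n.+1%:R :> R by [].
have K0 : 0 <= 2 * M * n.+1%:R ^+ 2 * enorm (x - y) ^+ 2.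
  by rewrite !mulr_ge0// ?sqr_ge0 ?enorm_ge0.
rewrite indicE; have [Oy|Oy] := pselect (oscillation_set e n y).
  rewrite mem_set// mulr1; lra.
rewrite memNset// mulr0 addr0.
have [yx|yx] := pselect (ball y n.+1%:R^-1 x).
  suff : `|g_ m x - g y| <= e by lra.
  rewrite leNgt; apply/negP => lt; apply: Oy.
  exists x, y, (g_ m x), (g y); split => //.
  - by apply: ballxx; rewrite invr_gt0.
  - by right; exists m.
  - by left.
have : n.+1%:R^-1 <= enorm (x - y).
  rewrite leNgt; apply/negP => lt; apply: yx.
  rewrite -ball_normE/=; apply: le_lt_trans lt.
  by rewrite distrC; exact: norm_le_enorm.
rewrite -[leLHS]mul1r ler_pdivrMr// => h.
have h2 : 1 <= n.+1%:R ^+ 2 * enorm (x - y) ^+ 2.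
  by rewrite -exprMn mulrC exprn_ege1.
have : 2 * M <= 2 * M * (n.+1%:R ^+ 2 * enorm (x - y) ^+ 2).
  by rewrite ler_peMr// mulr_ge0.
rewrite mulrA; lra.
Qed.

Lemma integral_cvg_coupling : wasserstein2 (mu_ m) mu @[m --> \oo] --> 0%E ->
  (\int[mu_ m]_x (g_ m x)%:E)%E @[m --> \oo] --> (\int[mu]_x (g x)%:E)%E.
Proof.
move=> W0.
have M0 : 0 <= M := le_trans (normr_ge0 _) (gM 0).
have pfin (P : probability 'rV[R]_N R) : (P setT < +oo)%E.
  by apply: (@le_lt_trans _ _ 1%E); [exact: probability_le1|rewrite ltry].
have gi := integrable_le_cst (pfin mu) mg gM.
have g_i m := integrable_le_cst (pfin (mu_ m)) (mg_ m) (g_M m).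
have fin_ m : (\int[mu_ m]_x (g_ m x)%:E)%E \is a fin_num :=
  integrable_fin_num measurableT (g_i m).
have fin : (\int[mu]_x (g x)%:E)%E \is a fin_num :=
  integrable_fin_num measurableT gi.
rewrite -(fineK fin); apply/fine_cvgP; split; first exact: nearW.
apply/cvgrPdist_lt => e e0.
(* Three error terms, each at most [e / 4], leave room for the strict inequality. First [n] is fixed
   through the oscillation set, then [eta] through [L], which depends on [n], and only then [m]. The
   [+ 1] in [K] and in [L + 1] keeps the divisors positive. *)
pose e1 := e / 4; have e10 : 0 < e1 by rewrite divr_gt0.
pose K := 2 * M + 1; have K0 : 0 < K by rewrite /K; lra.
have [n On] := oscillation_set_cvg0 e10 (divr_gt0 e10 K0).
pose L := 2 * M * n.+1%:R ^+ 2.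
have L0 : 0 <= L by rewrite !mulr_ge0// sqr_ge0.
pose eta := e1 / (L + 1); have eta0 : 0 < eta by rewrite divr_gt0// ltr_wpDl.
near=> m.
have nm : (n <= m)%N by near: m; exact: nbhs_infty_ge.
have : (wasserstein2 (mu_ m) mu < (Num.sqrt eta)%:E)%E.
  by near: m; apply: (W0 _ (open_ereal_lt' _)); rewrite lte_fin sqrtr_gt0.
move=> /(wasserstein2_lt eta0)[rho rhoc rhoI].
have rfin : (rho setT < +oo)%E.
  by apply: (@le_lt_trans _ _ 1%E); [exact: probability_le1|rewrite ltry].
have mfst : measurable_fun setT (@fst 'rV[R]_N 'rV[R]_N) by [].
have msnd : measurable_fun setT (@snd 'rV[R]_N 'rV[R]_N) by [].
have i1 : rho.-integrable setT (EFin \o (g_ m \o fst)).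
  apply: (@integrable_le_cst _ _ _ _ _ M) => //.
    exact: (measurableT_comp (mg_ m) mfst).
  by move=> p; exact: g_M.
have i2 : rho.-integrable setT (EFin \o (g \o snd)).
  apply: (@integrable_le_cst _ _ _ _ _ M) => //.
    exact: (measurableT_comp mg msnd).
  by move=> p; exact: gM.
have E1 : (\int[rho]_p (g_ m p.1)%:E = \int[mu_ m]_x (g_ m x)%:E)%E.
  apply: (integral_coupling_fst rhoc (f := EFin \o g_ m)) => //.
  exact/measurable_EFinP.
have E2 : (\int[rho]_p (g p.2)%:E = \int[mu]_x (g x)%:E)%E.
  apply: (integral_coupling_snd rhoc (f := EFin \o g)) => //.
  exact/measurable_EFinP.
have mO : measurable (oscillation_set e1 n).
  by apply: measurable_open_rV; exact: open_oscillation_set.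
have mind : measurable_fun setT (\1_(oscillation_set e1 n) : 'rV[R]_N -> R).
  exact: measurable_indic.
have mind2 := measurableT_comp mind msnd.
have mOs : measurable_fun setT (fun p : 'rV[R]_N * 'rV[R]_N =>
    K * \1_(oscillation_set e1 n) p.2).
  exact: measurable_funM.
have mq : measurable_fun setT (fun p : 'rV[R]_N * 'rV[R]_N =>
    L * enorm (p.1 - p.2) ^+ 2).
  apply: measurable_funM => //; apply: measurable_funX.
  exact: measurable_enorm_sub.
have B : (`|\int[mu_ m]_x (g_ m x)%:E - \int[mu]_x (g x)%:E| <=
    \int[rho]_p (e1 + K * \1_(oscillation_set e1 n) p.2 +
      L * enorm (p.1 - p.2) ^+ 2)%:E)%E.
  rewrite -E1 -E2; apply: abse_integralB_le => //.
    by apply: measurable_funD => //; exact: measurable_funD.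
  move=> p; apply: le_trans (value_dist_le p.1 p.2 (ltW e10) nm) _.
  rewrite lerD2r lerD2l ler_wpM2r// /K; lra.
have h0 p : (0 <= (K * \1_(oscillation_set e1 n) p.2)%:E)%E :> Prop.
  by rewrite lee_fin mulr_ge0// ltW.
have h1 p : (0 <= (L * enorm (p.1 - p.2) ^+ 2)%:E)%E :> Prop.
  by rewrite lee_fin mulr_ge0// sqr_ge0.
have hE : (\int[rho]_p (e1 + K * \1_(oscillation_set e1 n) p.2 +
    L * enorm (p.1 - p.2) ^+ 2)%:E = e1%:E + K%:E * mu (oscillation_set e1 n) +
    L%:E * \int[rho]_p (enorm (p.1 - p.2) ^+ 2)%:E)%E.
  under eq_integral do rewrite EFinD [X in (X + _)%E]EFinD.
  rewrite ge0_integralD//; first last.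
  - exact/measurable_EFinP.
  - by apply/measurable_EFinP; exact: measurable_funD.
  - by move=> p _; rewrite adde_ge0// lee_fin ltW.
  rewrite ge0_integralD//; first last.
  - exact/measurable_EFinP.
  - by move=> p _; rewrite lee_fin ltW.
  rewrite (integral_cst_probability rho); congr (_ + _ + _)%E.
    under eq_integral do rewrite EFinM.
    rewrite ge0_integralZl_EFin//; last 2 first.
    - by apply/measurable_EFinP; exact: mind2.
    - exact: ltW.
    rewrite (ge0_integral_coupling_snd rhoc
      (f := fun y => (\1_(oscillation_set e1 n) y)%:E)).
    - by rewrite integral_indic// setIT.
    - exact/measurable_EFinP.
    - by move=> y; rewrite lee_fin.
  under eq_integral do rewrite EFinM.
  rewrite ge0_integralZl_EFin//.
  - by move=> p _; rewrite lee_fin sqr_ge0.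
  - apply/measurable_EFinP; apply: measurable_funX.
    exact: measurable_enorm_sub.
have [b b0 bE] : exists2 r, 0 <= r & mu (oscillation_set e1 n) = r%:E.
  by exists (fine (mu (oscillation_set e1 n)));
    rewrite ?fine_ge0// fineK// fin_num_measure.
have [q q0 qE] : exists2 r, 0 <= r &
    (\int[rho]_p (enorm (p.1 - p.2) ^+ 2)%:E)%E = r%:E.
  have q0 : (0 <= \int[rho]_p (enorm (p.1 - p.2) ^+ 2)%:E)%E.
    by apply: integral_ge0 => p _; rewrite lee_fin sqr_ge0.
  exists (fine (\int[rho]_p (enorm (p.1 - p.2) ^+ 2)%:E)); rewrite ?fine_ge0//.
  by rewrite fineK// ge0_fin_numE// (lt_trans rhoI)// ltry.
move: B; rewrite hE bE qE -(fineK (fin_ m)) -[X in (`|_ - X|)%E](fineK fin).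
rewrite -EFinB abse_EFin -!EFinM -!EFinD lee_fin distrC => /le_lt_trans; apply.
have Kb : K * b < e1.
  by move: On; rewrite bE lte_fin ltr_pdivlMr// mulrC.
have Lq : L * q <= e1.
  have : (L + 1) * q <= e1.
    by move: rhoI; rewrite qE lte_fin ltr_pdivlMr ?ltr_wpDl// mulrC => /ltW.
  lra.
rewrite /e1 in Kb Lq *; lra.
Unshelve. all: by end_near. Qed.

End convergence_along_couplings.

(** * Local stability of Voronoi cells *)

Section voronoi_convergence.
Context {R : realType} {N k : nat}.
Variables (z_ : nat -> 'I_k -> 'rV[R]_N) (z : 'I_k -> 'rV[R]_N).
Hypothesis k_gt0 : (0 < k)%N.
Hypothesis z_cvg : forall i, z_ m i @[m --> \oo] --> z i.

Lemma near_closer (y : 'rV[R]_N) i j : enorm (y - z i) < enorm (y - z j) ->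
  \forall n \near \oo, \forall x \near y,
    enorm (x - z i) < enorm (x - z j) /\
    forall m, (n <= m)%N -> enorm (x - z_ m i) < enorm (x - z_ m j).
Proof.
move=> yij; pose d := (enorm (y - z j) - enorm (y - z i)) / 4.
have d0 : 0 < d by rewrite divr_gt0// subr_gt0.
have [n _ zn] : \forall m \near \oo,
    enorm (z_ m i - z i) < d /\ enorm (z_ m j - z j) < d.
  near=> m; split; near: m; exact: enorm_cvg0.
exists n => // l /= nl; have := near_enorm_lt y d0.
move=> yd; near=> x.
have xy : enorm (x - y) < d by near: x; exact: yd.
have hi := enormB_le x y (z i).
have hj := enormB_le y x (z j); rewrite (enormBC y x) in hj.
split; first by rewrite /d in xy; lra.
move=> m lm; have [mi mj] := zn m (leq_trans nl lm).
have hmi := enormB_le x (z i) (z_ m i); rewrite (enormBC (z i)) in hmi.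
have hmj := enormB_le x (z_ m j) (z j).
rewrite /d in xy mi mj; lra.
Unshelve. all: by end_near. Qed.

Lemma voronoi_closer (w : 'I_k -> 'rV[R]_N) i x :
  (forall j, j != i -> enorm (x - w i) < enorm (x - w j)) -> voronoi w i x.
Proof.
move=> xi; rewrite voronoiE => j _ /=.
by have [->|ji] := eqVneq j i; rewrite subr_le0// ltW// xi.
Qed.

Lemma notin_voronoi (w : 'I_k -> 'rV[R]_N) i j x :
  enorm (x - w j) < enorm (x - w i) -> ~ voronoi w i x.
Proof.
by move=> xj; rewrite /voronoi/= => xi; have := edist_set_le w x j;
  rewrite xi leNgt xj.
Qed.

(** If [y] is outside the cell, some [z j] is strictly closer and nearby points are outside all late
    cells. If [y] is inside and off the boundaries, [z i] is strictly closest, nearby points are in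
    all late cells, and continuity of [f] remains. *)
Lemma voronoi_cvg (f : 'rV[R]_N -> R) i y :
  {for y, continuous f} ->
  (forall j, j != i -> ~ (voronoi z i `&` voronoi z j) y) ->
  forall e, 0 < e -> exists n, \forall x \near y,
    `|f x * \1_(voronoi z i) x - f y * \1_(voronoi z i) y| <= e /\
    forall m, (n <= m)%N ->
      `|f x * \1_(voronoi (z_ m) i) x - f y * \1_(voronoi z i) y| <= e.
Proof.
move=> cf yb e e0.
have [yi|yi] := pselect (voronoi z i y); last first.
  have [j yj] := edist_set_attained k_gt0 z y.
  have yji : enorm (y - z j) < enorm (y - z i).
    rewrite lt_neqAle -yj edist_set_le andbT; exact/eqP.
  have [n _ /(_ n (leqnn n)) near_n] := near_closer yji.
  exists n; near=> x.
  have [xz xzm] : enorm (x - z j) < enorm (x - z i) /\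
    forall m, (n <= m)%N -> enorm (x - z_ m j) < enorm (x - z_ m i).
    by near: x; exact: near_n.
  have out (w : 'I_k -> 'rV[R]_N) : enorm (x - w j) < enorm (x - w i) ->
      `|f x * \1_(voronoi w i) x - f y * \1_(voronoi z i) y| <= e.
    move=> /notin_voronoi xw; rewrite !indicE !memNset// !mulr0 subrr normr0.
    exact: ltW.
  by split=> [|m nm]; apply: out => //; exact: xzm.
(* There are finitely many indices [j], so one [n] and then one neighbourhood suit them all. *)
have closer : \forall n \near \oo, forall j, j != i -> \forall x \near y,
    enorm (x - z i) < enorm (x - z j) /\
    forall m, (n <= m)%N -> enorm (x - z_ m i) < enorm (x - z_ m j).
  apply: filter_forall => j; have [->|ji] := eqVneq j i; first exact: nearW.
  have yij : enorm (y - z i) < enorm (y - z j).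
    rewrite lt_neqAle -{2}yi edist_set_le andbT; apply/eqP => yij.
    by apply: (yb j ji); split => //; rewrite /voronoi/= yi.
  by have := near_closer yij; apply: filterS.
have [n _ /(_ n (leqnn n)) near_n] := closer.
exists n.
have near_n' : \forall x \near y, forall j, j != i ->
    enorm (x - z i) < enorm (x - z j) /\
    forall m, (n <= m)%N -> enorm (x - z_ m i) < enorm (x - z_ m j).
  apply: (@filter_forall _ _ _ _ (nbhs_filter y)) => j.
  have [->|ji] := eqVneq j i; first exact: nearW.
  by have := near_n j ji; apply: filterS.
have near_f : \forall x \near y, `|f y - f x| < e.
  by have /(@cvgrPdist_lt _ _ _ _ (nbhs_filter y)) := cf; exact.
near=> x.
have xz : forall j, j != i -> enorm (x - z i) < enorm (x - z j) /\
    forall m, (n <= m)%N -> enorm (x - z_ m i) < enorm (x - z_ m j).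
  by near: x; exact: near_n'.
have fx : `|f x - f y| <= e by rewrite distrC ltW//; near: x; exact: near_f.
have inw (w : 'I_k -> 'rV[R]_N) : voronoi w i x ->
    `|f x * \1_(voronoi w i) x - f y * \1_(voronoi z i) y| <= e.
  by move=> xw; rewrite !indicE !mem_set// !mulr1.
split=> [|m nm]; apply: inw; apply: voronoi_closer => j ji.
  by have [] := xz j ji.
by have [_] := xz j ji; exact.
Unshelve. all: by end_near. Qed.

End voronoi_convergence.

Unset Implicit Arguments.
Set Strict Implicit.

Theorem corollary1p9 (R : realType) (N k : nat)
    (mu : probability 'rV[R]_N R) (mu_ : nat -> probability 'rV[R]_N R)
    (z_ : nat -> 'I_k -> 'rV[R]_N) (z : 'I_k -> 'rV[R]_N) (phi : nat -> nat)
    (k_ge1 : (1 <= k)%N)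
    (mu_fin2 : finite_second_moment mu)
    (mu_supp : [set: 'I_k] #<= supp mu)
    (mum_fin2 : forall m, finite_second_moment (mu_ m))
    (mum_cvg : wasserstein2 (mu_ m) mu @[m --> \oo] --> 0%E)
    (z_min : forall m, is_minimizer (mu_ m) (z_ m))
    (phi_incr : {homo phi : m n / (m < n)%N})
    (z_cvg : forall i, z_ (phi m) i @[m --> \oo] --> z i) :
  forall i : 'I_k,
    weak_cvg
      (fun m => mrestr (mu_ (phi m)) (measurable_voronoi (z_ (phi m)) i))
      (mrestr mu (measurable_voronoi z i)).
Proof.
move=> i f cf bf.
have phi_oo : phi m @[m --> \oo] --> \oo.
  have phi_ge m : (m <= phi m)%N.
    by elim: m => // m IH; apply: leq_ltn_trans IH _; exact: phi_incr.
  move=> A [n _ nA]; exists n => // m /= nm.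
  by apply: nA; exact: leq_trans nm (phi_ge m).
have W0 : wasserstein2 (mu_ (phi m)) mu @[m --> \oo] --> 0%E.
  exact: cvg_comp phi_oo mum_cvg.
have zmin : is_minimizer mu z.
  exact: (is_minimizer_limit k_ge1 mu_fin2 W0 (fun m => z_min (phi m)) z_cvg).
have zinj := minimizer_injective k_ge1 mu_fin2 mu_supp zmin.
have mf : measurable_fun setT f := continuous_measurable_rV cf.
have [M fM] : exists M, forall x, `|f x| <= M.
  by have [M [_ hM]] := bf; exists (M + 1) => x; apply: hM; rewrite ?ltrDl.
have Vfin (P : probability 'rV[R]_N R) (D : set 'rV[R]_N) (mD : measurable D) :
    (mrestr P mD setT < +oo)%E.
  rewrite /mrestr setTI.
  by apply: (@le_lt_trans _ _ 1%E); [exact: probability_le1|rewrite ltry].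
have fE (P : probability 'rV[R]_N R) (D : set 'rV[R]_N) (mD : measurable D) :
    (\int[mrestr P mD]_x (f x)%:E = \int[P]_x (f x * \1_D x)%:E)%E.
  by apply: integral_mrestr; exact: (integrable_le_cst (Vfin P D mD) mf fM).
(* The varying restrictions become varying integrands [f x * \1_D x] against the full measures. *)
rewrite fE; under eq_fun do rewrite fE.
have mfD (D : set 'rV[R]_N) : measurable D ->
    measurable_fun setT (fun x => f x * \1_D x).
  by move=> mD; apply: measurable_funM => //; exact: measurable_indic.
have fDM (D : set 'rV[R]_N) x : `|f x * \1_D x| <= M.
  rewrite normrM; apply: le_trans (fM x); rewrite ler_piMr// indicE.
  by case: (_ \in _); rewrite ?normr1// normr0.
apply: (integral_cvg_coupling (M := M)
  (g_ := fun m x => f x * \1_(voronoi (z_ (phi m)) i) x)) => //.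
- by move=> m; apply: mfD; exact: measurable_voronoi.
- by apply: mfD; exact: measurable_voronoi.
(* Distinct indices give distinct points by [zinj], so each of the finitely many boundaries is
   null. *)
have : {ae mu, forall y j, j != i -> ~ (voronoi z i `&` voronoi z j) y}.
  apply: filter_forall => j; have [->|ji] := eqVneq j i; first exact: nearW.
  exists (voronoi z i `&` voronoi z j); split.
  - by apply: measurableI; exact: measurable_voronoi.
  - apply: (minimizer_boundary_null k_ge1 mu_fin2 zmin).
    by apply: contra_neq ji => /zinj.
  - by move=> y /= h; apply: contrapT => yV; apply: h => _; exact: yV.
apply: filterS => y yb.
exact: (voronoi_cvg k_ge1 z_cvg (cf y) yb).
Qed.
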